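(* Let $\Gamma$ be a subgroup of $\mathbf\Gamma(1)$ such that $\Gamma\cap K\neq\{1\}$. Then $P_\Gamma F_{k,m}=0$ for all $k\in\mathbb Z_{\ge0}$ and $m\in\frac52+\mathbb Z_{\ge0}$.
   Context: Let $\mathcal H=\{z\in\mathbb C:\Im z>0\}$, let $\mathrm{Hol}(\mathcal H)$ be the space of holomorphic functions on $\mathcal H$, and let $g.z=\frac{az+b}{cz+d}$, $j(g,z)=cz+d$ for $g=\begin{pmatrix}a&b\\c&d\end{pmatrix}$. The square root $\sqrt{\cdot}$ is the branch with values in $\{\Re>0\}\cup\{\Re=0,\Im\ge0\}$, and $z^m:=(\sqrt z)^{2m}$ for half-integral $m$. The metaplectic group is $\mathrm{SL}_2(\mathbb R)^\sim=\{\sigma=(g_\sigma,\eta_\sigma)\in\mathrm{SL}_2(\mathbb R)\times\mathrm{Hol}(\mathcal H):\eta_\sigma(z)^2=j(g_\sigma,z)\ \forall z\in\mathcal H\}$ with multiplication $\sigma_1\sigma_2=(g_{\sigma_1}g_{\sigma_2},\ \eta_{\sigma_1}(g_{\sigma_2}.z)\eta_{\sigma_2}(z))$; it is a double cover of $\mathrm{SL}_2(\mathbb R)$ via $\pi_1(\sigma)=g_\sigma$. $K=\pi_1^{-1}(\mathrm{SO}_2(\mathbb R))$, and $\mathbf\Gamma(1)=\pi_1^{-1}(\mathrm{SL}_2(\mathbb Z))$, a discrete subgroup. For $k\in\mathbb Z_{\ge0}$ and $m\in\frac52+\mathbb Z_{\ge0}$, $f_{k,m}(z)=(2i)^m\frac{(z-i)^k}{(z+i)^{m+k}}$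 for $z\in\mathcal H$, and $F_{k,m}(\sigma)=f_{k,m}(g_\sigma.i)\,\eta_\sigma(i)^{-2m}$ for $\sigma\in\mathrm{SL}_2(\mathbb R)^\sim$. $(P_\Gamma F_{k,m})(\sigma)=\sum_{\gamma\in\Gamma}F_{k,m}(\gamma\sigma)$; for discrete $\Gamma$ this series converges absolutely and uniformly on compact sets. *)

(* Defs.v *)
From HB Require Import structures.
From mathcomp Require Import all_boot all_order all_algebra.
From mathcomp Require Import all_classical all_reals all_analysis.
From mathcomp Require Import complex.
From mathcomp Require Import summability.
From mathcomp Require Import ring lra.

Set Implicit Arguments.
Unset Strict Implicit.
Unset Printing Implicit Defensive.

Import Order.TTheory GRing.Theory Num.Theory.
Import numFieldNormedType.Exports.

Local Open Scope classical_set_scope.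
Local Open Scope ring_scope.

Section SL2.
Context {R : comUnitRingType}.

Record SL2 := MkSL2 { SL2_mx :> 'M[R]_2; SL2_det : \det SL2_mx == 1 }.

HB.instance Definition _ := [isSub for SL2_mx].
HB.instance Definition _ := [Choice of SL2 by <:].

Implicit Types g h : SL2.

Lemma SL2_mul_subproof g h : \det (g *m h) == 1.
Proof. by rewrite det_mulmx (eqP (SL2_det g)) (eqP (SL2_det h)) mulr1. Qed.
Definition SL2_mul g h : SL2 := MkSL2 (SL2_mul_subproof g h).

Lemma SL2_one_subproof : \det (1%:M : 'M[R]_2) == 1.
Proof. by rewrite det1. Qed.
Definition SL2_one : SL2 := MkSL2 SL2_one_subproof.

Lemma SL2_unit g : (g : 'M[R]_2) \in unitmx.
Proof. by rewrite unitmxE (eqP (SL2_det g)) unitr1. Qed.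

Lemma SL2_inv_subproof g : \det (invmx g) == 1.
Proof. by rewrite det_inv (eqP (SL2_det g)) invr1. Qed.
Definition SL2_inv g : SL2 := MkSL2 (SL2_inv_subproof g).

Lemma SL2_mulA : associative SL2_mul.
Proof. by move=> g h k; apply: val_inj; rewrite /= mulmxA. Qed.
Lemma SL2_mul1 : left_id SL2_one SL2_mul.
Proof. by move=> g; apply: val_inj; rewrite /= mul1mx. Qed.
Lemma SL2_mulr1 : right_id SL2_one SL2_mul.
Proof. by move=> g; apply: val_inj; rewrite /= mulmx1. Qed.
Lemma SL2_mulV : left_inverse SL2_one SL2_inv SL2_mul.
Proof. by move=> g; apply: val_inj; rewrite /= mulVmx // SL2_unit. Qed.
Lemma SL2_mulrV : right_inverse SL2_one SL2_inv SL2_mul.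
Proof. by move=> g; apply: val_inj; rewrite /= mulmxV // SL2_unit. Qed.

HB.instance Definition _ := isGroup.Build SL2
  SL2_mulA SL2_mul1 SL2_mulr1 SL2_mulV SL2_mulrV.

Lemma SL2_detE g : g 0 0 * g 1 1 - g 0 1 * g 1 0 = 1.
Proof.
rewrite -(eqP (SL2_det g)) (expand_det_row _ 0) big_ord_recl big_ord1.
rewrite /cofactor !det_mx11 !mxE /= !addn0 expr0 expr1 mul1r mulN1r mulrN.
by congr (_ * g _ _ - g _ _ * g _ _); apply: val_inj.
Qed.

End SL2.
Arguments SL2 R : clear implicits.

Section UpperHalfPlane.
Context {R : realType}.
Local Notation C := R[i].
Implicit Types (g h : SL2 R) (z w : C).

Record HH := MkHH { HH_val :> C; HH_im : 0 < complex.Im HH_val }.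

HB.instance Definition _ := [isSub for HH_val].
HB.instance Definition _ := [Choice of HH by <:].

Lemma HHi_subproof : 0 < complex.Im ('i%C : C).
Proof. exact: ltr01. Qed.
Definition HHi : HH := MkHH HHi_subproof.

Definition factor_j g (z : C) : C := (g 1 0)%:C%C * z + (g 1 1)%:C%C.

Definition mobius g (z : C) : C :=
  ((g 0 0)%:C%C * z + (g 0 1)%:C%C) / factor_j g z.

Lemma factor_j_neq0 g (z : C) : 0 < complex.Im z -> factor_j g z != 0.
Proof.
have := SL2_detE g; case: z => x y /= d y0; rewrite /factor_j.
simpc; rewrite eq_complex /= negb_and.
have [c0|c0] := eqVneq (g 1 0) 0; last first.
  by rewrite orbC mulf_neq0 // gt_eqF.
rewrite c0 mul0r add0r; apply/orP; left; apply/eqP => d0.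
by move: d; rewrite c0 d0 !mulr0 subr0 => /eqP; rewrite eq_sym oner_eq0.
Qed.

Lemma mobius_im g (z : C) :
  0 < complex.Im z -> 0 < complex.Im (mobius g z).
Proof.
have := SL2_detE g; move=> d zp; move: (factor_j_neq0 g zp); move: d zp.
case: z => x y /=; rewrite /mobius /factor_j; set a := g 0 0; set b := g 0 1.
set c := g 1 0; set e := g 1 1 => d y0; simpc.
rewrite eq_complex /= negb_and => nz.
set u := c * x + e; set v := c * y.
have N : 0 < u ^+ 2 + v ^+ 2.
  rewrite lt0r addr_ge0 ?sqr_ge0 // andbT paddr_eq0 ?sqr_ge0 //.
  by rewrite !sqrf_eq0 negb_and.
rewrite [X in 0 < X](_ : _ = (a * e - b * c) * y / (u ^+ 2 + v ^+ 2)).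
  by rewrite d mul1r divr_gt0.
by rewrite /u /v; field; rewrite -/u -/v gt_eqF.
Qed.

Definition act g (z : HH) : HH := MkHH (mobius_im g (HH_im z)).

Lemma lift01 : lift ord0 ord0 = 1 :> 'I_2.
Proof. exact: val_inj. Qed.

Lemma factor_jM g h (z : HH) :
  factor_j (g * h)%g z = factor_j g (act h z) * factor_j h z.
Proof.
have := factor_j_neq0 h (HH_im z).
rewrite /act /= /mobius /factor_j /= !mxE !big_ord_recl !big_ord0 !addr0.
rewrite !lift01 -[ord0]/(0 : 'I_2) !rmorphD !rmorphM /= => nz.
by field.
Qed.

Lemma factor_j1 (z : HH) : factor_j (1%g : SL2 R) z = 1.
Proof. by rewrite /factor_j !mxE /= mul0r add0r. Qed.

Lemma act1 (z : HH) : act 1%g z = z.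
Proof.
apply: val_inj; rewrite /= /mobius factor_j1 divr1 !mxE /=.
by rewrite mul1r addr0.
Qed.

Lemma actM g h (z : HH) : act (g * h)%g z = act g (act h z).
Proof.
apply: val_inj => /=.
have := factor_j_neq0 (g * h)%g (HH_im z).
have := factor_j_neq0 h (HH_im z).
rewrite /mobius => nz; rewrite factor_jM => nz'.
have nz2 : factor_j g (act h z) != 0.
  by apply: contra nz' => /eqP ->; rewrite mul0r.
apply: (mulIf nz'); rewrite divfK //.
rewrite -[factor_j g (_ / _)]/(factor_j g (act h z)) [RHS]mulrA divfK //.
rewrite /= /mobius /= !mxE !big_ord_recl !big_ord0 !addr0.
rewrite !lift01 -[ord0]/(0 : 'I_2) !rmorphD !rmorphM /=.
by move: nz; rewrite /factor_j => nz; field.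
Qed.

(* Extension by 0: its values off the open half-plane do not affect
   differentiability inside it. The derivative below is the complex one, since
   C^o is a normed module over C. *)
Definition extend (f : HH -> C) : C^o -> C^o :=
  fun w => if insub w is Some z then f z else 0.

Definition holomorphic (f : HH -> C) :=
  forall z : HH, derivable (extend f) (HH_val z : C^o) 1.

Lemma extendE f (z : HH) : extend f (HH_val z) = f z.
Proof. by rewrite /extend; rewrite -[HH_val z]/(val z) valK. Qed.

Lemma extend_sub f (w : C) (w0 : 0 < complex.Im w) : extend f w = f (MkHH w0).
Proof. by rewrite -[w]/(HH_val (MkHH w0)) extendE. Qed.

Lemma near_HH (z : HH) : \forall w \near (HH_val z : C^o), 0 < complex.Im w.
Proof.
have y0 := HH_im z.
have e0 : 0 < (complex.Im z)%:C%C :> C by rewrite ltcR.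
apply/nbhs_ballP; exists (complex.Im z)%:C%C => // w.
rewrite /ball /= normc_def ltcR raddfB /= => zw.
have : `|complex.Im (HH_val z) - complex.Im w| < complex.Im (HH_val z).
  apply: le_lt_trans zw; rewrite -sqrtr_sqr; apply: ler_wsqrtr.
  by rewrite raddfB /= lerDr sqr_ge0.
move=> /(le_lt_trans (ler_norm _)); lra.
Qed.

Lemma holomorphic_cst (c : C) : holomorphic (fun=> c).
Proof.
move=> z; apply: (@near_eq_derivable _ _ _ (cst (c : C^o))).
- by near=> w; rewrite (extend_sub _ (_ : 0 < complex.Im w)) //; near: w; exact: near_HH.
- exact: derivable_cst.
Unshelve. all: by end_near. Qed.

Lemma holomorphicM f f' : holomorphic f -> holomorphic f' ->
  holomorphic (fun z : HH => f z * f' z).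
Proof.
move=> fh fh' z; apply: (@near_eq_derivable _ _ _ (extend f * extend f')).
- near=> w; have w0 : 0 < complex.Im w by near: w; exact: near_HH.
  by rewrite /= /GRing.mul /= !(extend_sub _ w0).
- exact: derivableM.
Unshelve. all: by end_near. Qed.

Lemma holomorphicV f : (forall z : HH, f z != 0) -> holomorphic f ->
  holomorphic (fun z : HH => (f z)^-1).
Proof.
move=> f0 fh z.
apply: (@near_eq_derivable _ _ _ (fun w : C^o => (extend f w)^-1 : C^o)).
- near=> w; have w0 : 0 < complex.Im w by near: w; exact: near_HH.
  by rewrite /= !(extend_sub _ w0).
- by apply: derivableV => //; rewrite extendE.
Unshelve. all: by end_near. Qed.

Lemma mobius_derivable g (z : HH) :
  derivable (mobius g : C^o -> C^o) (HH_val z) 1.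
Proof.
apply: (@derivableM _ _ (fun w : C^o => (g 0 0)%:C%C * w + (g 0 1)%:C%C)
  (fun w : C^o => (factor_j g w)^-1)).
  by apply: derivableD => //; apply: derivableM.
apply: derivableV; first exact: factor_j_neq0 (HH_im z).
by apply: derivableD => //; apply: derivableM.
Qed.

Lemma holomorphic_act f g : holomorphic f -> holomorphic (fun z : HH => f (act g z)).
Proof.
move=> fh z.
apply: (@near_eq_derivable _ _ _ (extend f \o (mobius g : C^o -> C^o))).
- near=> w; have w0 : 0 < complex.Im w by near: w; exact: near_HH.
  by rewrite /= (extend_sub _ w0) (extend_sub _ (mobius_im g w0)).
- apply/derivable1_diffP; apply: differentiable_comp.
    by apply/derivable1_diffP; exact: mobius_derivable.
  by apply/derivable1_diffP; exact: (fh (act g z)).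
Unshelve. all: by end_near. Qed.

End UpperHalfPlane.
Arguments HH R : clear implicits.

Section Metaplectic.
Context {R : realType}.
Local Notation C := R[i].

Record Mp := MkMp {
  mp_pi : SL2 R;
  mp_eta : HH R -> C;
  mp_hol : holomorphic mp_eta;
  mp_sqr : forall z : HH R, mp_eta z ^+ 2 = factor_j mp_pi z }.

HB.instance Definition _ := gen_eqMixin Mp.
HB.instance Definition _ := gen_choiceMixin Mp.

Lemma Mp_eq (s t : Mp) : mp_pi s = mp_pi t -> mp_eta s =1 mp_eta t -> s = t.
Proof.
case: s t => [g e h q] [g' e' h' q'] /= gg' /funext ee'; subst g' e'.
by congr MkMp; exact: Prop_irrelevance.
Qed.

Lemma mp_eta_neq0 (s : Mp) z : mp_eta s z != 0.
Proof. by rewrite -sqrf_eq0 mp_sqr factor_j_neq0 // HH_im. Qed.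

Lemma Mp_mul_hol (s t : Mp) :
  holomorphic (fun z => mp_eta s (act (mp_pi t) z) * mp_eta t z).
Proof.
by apply: holomorphicM; [apply: holomorphic_act|]; exact: mp_hol.
Qed.

Lemma Mp_mul_sqr (s t : Mp) z :
  (mp_eta s (act (mp_pi t) z) * mp_eta t z) ^+ 2
  = factor_j (mp_pi s * mp_pi t)%g z.
Proof. by rewrite exprMn !mp_sqr factor_jM. Qed.

Definition Mp_mul (s t : Mp) : Mp := MkMp (@Mp_mul_hol s t) (Mp_mul_sqr s t).

Lemma Mp_one_sqr (z : HH R) : 1 ^+ 2 = factor_j (1%g : SL2 R) z.
Proof. by rewrite factor_j1 expr1n. Qed.

Definition Mp_one : Mp := MkMp (@holomorphic_cst R 1) Mp_one_sqr.

Lemma Mp_inv_hol (s : Mp) :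
  holomorphic (fun z => (mp_eta s (act (mp_pi s)^-1%g z))^-1).
Proof.
apply: holomorphicV => [z|]; first exact: mp_eta_neq0.
by apply: holomorphic_act; exact: mp_hol.
Qed.

Lemma Mp_inv_sqr (s : Mp) z :
  ((mp_eta s (act (mp_pi s)^-1%g z))^-1) ^+ 2 = factor_j (mp_pi s)^-1%g z.
Proof.
rewrite exprVn mp_sqr; set g := mp_pi s.
have := factor_jM g g^-1%g z; rewrite mulgV factor_j1 => e.
apply: (mulfI (factor_j_neq0 g (HH_im (act g^-1%g z)))).
by rewrite -e mulfV // (factor_j_neq0 g (HH_im (act g^-1%g z))).
Qed.

Definition Mp_inv (s : Mp) : Mp := MkMp (@Mp_inv_hol s) (Mp_inv_sqr s).

Lemma Mp_mulA : associative Mp_mul.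
Proof. by move=> s t u; apply: Mp_eq => [|z] /=; rewrite ?mulgA ?actM ?mulrA. Qed.
Lemma Mp_mul1 : left_id Mp_one Mp_mul.
Proof. by move=> s; apply: Mp_eq => [|z] /=; rewrite ?mul1g ?mul1r. Qed.
Lemma Mp_mulr1 : right_id Mp_one Mp_mul.
Proof. by move=> s; apply: Mp_eq => [|z] /=; rewrite ?mulg1 ?act1 ?mulr1. Qed.
Lemma Mp_mulV : left_inverse Mp_one Mp_inv Mp_mul.
Proof.
move=> s; apply: Mp_eq => [|z] /=; first by rewrite mulVg.
by rewrite -actM mulVg act1 mulVf // mp_eta_neq0.
Qed.
Lemma Mp_mulrV : right_inverse Mp_one Mp_inv Mp_mul.
Proof.
move=> s; apply: Mp_eq => [|z] /=; first by rewrite mulgV.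
by rewrite mulfV // mp_eta_neq0.
Qed.

HB.instance Definition _ := isGroup.Build Mp
  Mp_mulA Mp_mul1 Mp_mulr1 Mp_mulV Mp_mulrV.

Definition SO2 : set (SL2 R) := [set g | g *m (g : 'M[R]_2)^T = 1%:M].

Definition SL2Z : set (SL2 R) := [set g | forall i j, g i j \is a Num.int].

Definition K : set Mp := mp_pi @^-1` SO2.

Definition Gamma1 : set Mp := mp_pi @^-1` SL2Z.

(* z^m := (sqrt z)^(2m); meaningful for m in (1/2)Z, where numq (2 * m) is the
   integer 2m. sqrtc is the root with Re > 0, or Re = 0 and Im >= 0. *)
Definition hpow (z : C) (m : rat) : C := sqrtc z ^ numq (2 * m).

Definition f_km (k : nat) (m : rat) (z : HH R) : C :=
  hpow (2 * 'i%C) m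
    * ((HH_val z - 'i%C) ^+ k / hpow (HH_val z + 'i%C) (m + k%:R)).

Definition F_km (k : nat) (m : rat) (s : Mp) : C :=
  f_km k m (act (mp_pi s) HHi) * mp_eta s HHi ^ (- numq (2 * m)).

Definition poincare_sums (G : set Mp) (F : Mp -> C) (s : Mp) :=
  partial_sum (fun g : G => F (val g * s)%g : C^o).

(* Unordered convergence, along the directed set of finite subsets of G;
   in C this is the same as absolute convergence. *)
Definition poincare_converges (G : set Mp) (F : Mp -> C) :=
  forall s, cvg (@poincare_sums G F s @ totally).

(* The library's sum is 0 for a divergent series, so a statement about
   poincare G F says something only together with poincare_converges G F. *)
Definition poincare (G : set Mp) (F : Mp -> C) (s : Mp) : C :=
  sum (fun g : G => F (val g * s)%g : C^o).

End Metaplectic.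
Arguments Mp R : clear implicits.
Arguments poincare_sums {R} G F s A.

(* Main.v *)
Require Import Defs.
From mathcomp Require Import all_boot all_order all_algebra.
From mathcomp Require Import all_classical all_reals all_analysis.
From mathcomp Require Import complex.
From mathcomp Require Import summability finmap ring lra zify.

(* For kappa in K, the identity F_km(kappa s) = eta_kappa(i)^-(2m + 4k) F_km(s)
   follows from the equivariance of z - i and z + i under rotations; the choice
   of square roots is settled by comparing two continuous square roots on the
   connected half-plane, which agree at the fixed point i. If kappa lies over
   SL2(Z) then eta_kappa(i) is an 8th root of unity, and as 2m + 4k is odd the
   factor is 1 only for kappa = 1. A nontrivial kappa in Gamma thus shows that
   the Poincare series equals a multiple c != 1 of itself.

   For the convergence, |F_km(s)|^4 <= (4 / (|s|^2 + 2))^(2m), where |s| is the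
   Frobenius norm. A matrix (a b; c d) in SL2(Z) is determined by c, d and the
   integral part n of (ac + bd) / (c^2 + d^2), and its squared norm is at least
   (1 + |c|)(1 + |d|)(1 + |n|) / 9, so the series is dominated by the product of
   three convergent series of general term (1 + |n|)^(-5/4). *)

Set Implicit Arguments.
Unset Strict Implicit.
Unset Printing Implicit Defensive.

Import Order.TTheory GRing.Theory Num.Theory.
Import numFieldNormedType.Exports.

Local Open Scope classical_set_scope.
Local Open Scope ring_scope.

(** * Continuous square roots on the upper half-plane *)

Section SignRigidity.
Context {R : realType}.
Local Notation C := R[i].
Implicit Types (z w : C).

Lemma continuous_real_complex : continuous (fun x : R => x%:C%C : C^o).
Proof.
move=> x; apply/cvgrPdist_lt => e; case: e => e e' /= /andP[/eqP /= -> e0].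
near=> y; rewrite -rmorphB normc_def /= expr0n addr0 sqrtr_sqr ltcR.
by near: y; apply: cvgr_dist_lt => //; exact: cvg_id.
Unshelve. all: by end_near. Qed.

(* The segment from z0 to z1 is parametrised by sin^2, so that the path stays
   in the half-plane for all real times. *)
Lemma HH_locally_cst (q : C^o -> C^o) :
    (forall z : HH R, \forall w \near (HH_val z : C^o), q w = q z) ->
  forall z z' : HH R, q z = q z'.
Proof.
move=> qloc z0 z1.
pose p (t : R) : C^o := HH_val z0 + (sin t ^+ 2)%:C%C * (HH_val z1 - HH_val z0).
have pc t : {for t, continuous p}.
  apply: cvgD; first exact: cvg_cst.
  apply: cvgM; last exact: cvg_cst.
  apply: (@continuous_comp _ _ _ (fun t : R => sin t ^+ 2)
    (fun x : R => x%:C%C : C^o)); last exact: continuous_real_complex.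
  by apply: (@continuous_comp _ _ _ (@sin R) (fun x => x ^+ 2));
    [exact: continuous_sin | exact: exprn_continuous].
have pH t : 0 < complex.Im (p t).
  have := HH_im z0; have := HH_im z1; rewrite /p.
  case: (HH_val z0) (HH_val z1) => x y [x' y'] /= y'0 y0.
  have : 0 <= sin t ^+ 2 <= 1.
    by rewrite sqr_ge0 /= -(cos2Dsin2 t) lerDr sqr_ge0.
  move=> /andP[s0 s1]; rewrite mul0r addr0; nra.
have ploc t : \forall u \near t, q (p u) = q (p t).
  exact: (pc t) _ (qloc (MkHH (pH t))).
have derive0 (h : C -> R) (t : R) : is_derive t 1 (fun u => h (q (p u))) 0.
  apply: (@near_eq_is_derive _ _ _ (cst (h (q (p t))))).
  by near=> u; rewrite /= (near (ploc t) u).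
have cst0 (h : C -> R) := is_derive_0_is_cst 0 (pi / 2) (derive0 h).
have p0 : p 0 = HH_val z0 by rewrite /p sin0 expr0n /= mul0r addr0.
have p1 : p (pi / 2) = HH_val z1.
  by rewrite /p sin_pihalf expr1n mul1r addrC subrK.
move: (cst0 (@complex.Re R)) (cst0 (@complex.Im R)); rewrite p0 p1.
by case: (q _) (q _) => x y [x' y'] /= -> ->.
Unshelve. all: by end_near. Qed.

(** The quotient of [f] by [g] is continuous with square 1, so it is locally constant, hence
    constant by [HH_locally_cst], and its value at [z0] is 1. *)
Lemma sqr_eq_continuous (f g : C^o -> C^o) :
    (forall z : HH R, {for HH_val z, continuous f}) ->
    (forall z : HH R, {for HH_val z, continuous g}) ->
    (forall z : HH R, f z ^+ 2 = g z ^+ 2) -> (forall z : HH R, g z != 0) ->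
  forall z0 : HH R, f z0 = g z0 -> forall z : HH R, f z = g z.
Proof.
move=> fc gc fg g0 z0 fg0 z.
pose q : C^o -> C^o := fun w => f w / g w.
have q2 (w : HH R) : q w ^+ 2 = 1.
  by rewrite /q expr_div_n fg divff // sqrf_eq0.
suff qE : q z = 1 by rewrite -[LHS](divfK (g0 z)) -/(q z) qE mul1r.
rewrite (_ : 1 = q z0); last by rewrite /q fg0 divff.
apply: HH_locally_cst => {z} z.
have qc : {for HH_val z, continuous q}.
  exact: (cvgM (fc z) (cvgV (g0 z) (gc z))).
have /cvgrPdist_lt/(_ 1 ltr01) := qc.
move=> qn; near=> w.
have w0 : 0 < complex.Im w by near: w; exact: near_HH.
(* The possible values 1 and -1 are at distance 2, so a variation below 1 excludes a change of
   sign. *)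
have : `|q z - q w| < 1 by near: w; exact: qn.
move: (q2 z) (q2 (MkHH w0)) => /= qz qw.
have /eqP := qw; rewrite -qz -subr_eq0 subr_sqr mulf_eq0 subr_eq0 addr_eq0.
case/orP => /eqP -> //; rewrite opprK -mulr2n normrMn.
have -> : `|q z| = 1.
  by apply/eqP; rewrite -(@pexpr_eq1 _ _ 2) // -normrX qz normr1.
by rewrite qz -[X in _ < X]mulr1n ltr_nat.
Unshelve. all: by end_near. Qed.

Lemma sqrtc_Re_ge0 z : 0 <= complex.Re (sqrtc z).
Proof. by case: z => x y /=; rewrite sqrtr_ge0. Qed.

Lemma sqrtc_Im_gt0 z : 0 < complex.Im z -> 0 <= complex.Im (sqrtc z).
Proof.
case: z => x y /= y0; rewrite gt_eqF // gtr0_sg // mul1r; exact: sqrtr_ge0.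
Qed.

(* Both roots lie in the first quadrant, hence |s| <= |s + s'|, while
   (s - s') (s + s') = z - z'. *)
Lemma continuous_sqrtc (z : C^o) : 0 < complex.Im z ->
  {for z, continuous (@sqrtc R : C^o -> C^o)}.
Proof.
move=> z0; apply/(@cvgrPdist_lt _ C^o _ (nbhs z)) => e e0.
have s0 : 0 < `|sqrtc z|.
  by rewrite normr_gt0 sqrtc_eq0; apply: contraTneq z0 => ->; rewrite ltxx.
have zH : \forall w \near z, 0 < complex.Im w by exact: (near_HH (MkHH z0)).
have zb := @nbhsx_ballx _ C^o z _ (mulr_gt0 e0 s0).
apply: (@filterS2 _ (nbhs z) _ _ _ _ _ zH zb) => w w0 zw.
have sD : `|sqrtc z| <= `|sqrtc z + sqrtc w|.
  move: (sqrtc_Re_ge0 z) (sqrtc_Im_gt0 z0) (sqrtc_Re_ge0 w) (sqrtc_Im_gt0 w0).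
  case: (sqrtc z) (sqrtc w) => a b [c d] /= a0 b0 c0 d0.
  by rewrite !normc_def lecR /= ler_wsqrtr //; nra.
rewrite -(ltr_pM2r s0); apply: le_lt_trans zw.
rewrite -[in leRHS](sqr_sqrtc z) -[in leRHS](sqr_sqrtc w) subr_sqr normrM.
exact: ler_wpM2l.
Qed.

End SignRigidity.

(** * Equivariance of [F_km] under [K] *)

Section MetaplecticCharacter.
Context {R : realType}.
Local Notation C := R[i].
Implicit Types (s t u : Mp R).

Lemma holomorphic_continuous (f : HH R -> C) : holomorphic f ->
  forall z : HH R, {for HH_val z, continuous (extend f)}.
Proof.
by move=> fh z; apply: differentiable_continuous; apply/derivable1_diffP; exact: fh.
Qed.

(** Both factors are continuous square roots of the same nonvanishing function, so
    [sqr_eq_continuous] applies. *)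
Lemma mp_eta_inj s t (z0 : HH R) : mp_pi s = mp_pi t ->
  mp_eta s z0 = mp_eta t z0 -> s = t.
Proof.
move=> st e0; apply: Mp_eq => // z.
rewrite -(extendE (mp_eta s)) -(extendE (mp_eta t)).
apply: (sqr_eq_continuous (f := extend (mp_eta s)) (g := extend (mp_eta t))
  (@holomorphic_continuous _ (@mp_hol _ s)) (@holomorphic_continuous _ (@mp_hol _ t))
  _ _ (z0 := z0)) => [w|w|].
- by rewrite !extendE !mp_sqr st.
- by rewrite extendE mp_eta_neq0.
- by rewrite !extendE.
Qed.

(** The transpose and the adjugate are both inverse to [g]. In entries: multiply c and d by a^2 +
    b^2 = 1, then use the orthogonality of the rows and the determinant. *)
Lemma SO2_entries (g : SL2 R) : SO2 g -> g 1 1 = g 0 0 /\ g 1 0 = - g 0 1.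
Proof.
rewrite /SO2 /= => gg.
have d := SL2_detE g.
have e (i j : 'I_2) := congr1 (fun M : 'M[R]_2 => M i j) gg.
move: (e 0 0) (e 0 1) (e 1 1); rewrite !mxE !big_ord_recl !big_ord0 !mxE /=.
rewrite !lift01 -[ord0]/(0 : 'I_2) !addr0.
move: d; move: (g 0 0) (g 0 1) (g 1 0) (g 1 1) => a b c d D E1 E2 E3.
split; last first.
- have -> : c = c * (a * a + b * b) by rewrite E1 mulr1.
  have -> : c * (a * a + b * b) =
     a * (a * c + b * d) - b * (a * d - b * c) by ring.
  by rewrite E2 D mulr0 sub0r mulr1.
- have -> : d = d * (a * a + b * b) by rewrite E1 mulr1.
  have -> : d * (a * a + b * b) =
     b * (a * c + b * d) + a * (a * d - b * c) by ring.
  by rewrite E2 D mulr0 add0r mulr1.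
Qed.

Lemma SO2_act_i (g : SL2 R) : SO2 g -> act g HHi = HHi.
Proof.
move=> /SO2_entries[d c]; apply: val_inj => /=.
have := factor_j_neq0 g (HH_im HHi).
rewrite /mobius /factor_j d c /= => nz; apply: (mulIf nz); rewrite divfK //.
by apply/eqP; rewrite eq_complex /=; apply/andP; split; apply/eqP; ring.
Qed.

(** With d = a and c = -b the numerator of g.z + i is (a - bi)(z + i), and a - bi = j(g, i). *)
Lemma SO2_act_addi (g : SL2 R) (z : HH R) : SO2 g ->
  (HH_val (act g z) + 'i%C) * factor_j g z = factor_j g 'i%C * (HH_val z + 'i%C).
Proof.
move=> /SO2_entries[d c].
have nz := factor_j_neq0 g (HH_im z).
rewrite mulrDl /= /mobius divfK // /factor_j d c /=.
case: (HH_val z) => x y.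
by apply/eqP; rewrite eq_complex /=; apply/andP; split; apply/eqP; ring.
Qed.

(** Here the numerator is (a + bi)(z - i), and (a + bi) j(g, i) = a^2 + b^2 = 1. *)
Lemma SO2_act_subi (g : SL2 R) (z : HH R) : SO2 g ->
  (HH_val (act g z) - 'i%C) * factor_j g z * factor_j g 'i%C = HH_val z - 'i%C.
Proof.
move=> gS; have [d c] := SO2_entries gS; have := SL2_detE g.
have nz := factor_j_neq0 g (HH_im z).
rewrite mulrBl /= /mobius divfK // /factor_j d c /= => D.
case: (HH_val z) => x y.
move: D; move: (g 0 0) (g 0 1) => a b D.
apply/eqP; rewrite eq_complex /=; apply/andP; split; apply/eqP.
  transitivity (x * (a * a - b * - b)); last by rewrite D; ring.
  ring.
transitivity ((y - 1) * (a * a - b * - b)); last by rewrite D; ring.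
ring.
Qed.

(* The two sides have equal squares and agree at the fixed point i. *)
Lemma K_sqrtc_addi s (z : HH R) : K s ->
  sqrtc (HH_val (act (mp_pi s) z) + 'i%C) * mp_eta s z
  = mp_eta s HHi * sqrtc (HH_val z + 'i%C).
Proof.
rewrite /K /= => sK.
have addi_gt0 (w : C) : 0 < complex.Im w -> 0 < complex.Im (w + 'i%C).
  by case: w => x y /= y0; rewrite addr_gt0.
pose f (w : C^o) : C^o := sqrtc (mobius (mp_pi s) w + 'i%C) * extend (mp_eta s) w.
pose g (w : C^o) : C^o := mp_eta s HHi * sqrtc (w + 'i%C).
have shift (w : C^o) : {for w, continuous (fun w : C^o => w + 'i%C : C^o)}.
  exact: (@cvgD _ C^o _ (nbhs w) _ id (cst 'i%C) _ _ cvg_id (cvg_cst _)).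
have sqrtc_addi (w : C^o) : 0 < complex.Im w ->
    {for w, continuous (fun w : C^o => sqrtc (w + 'i%C) : C^o)}.
  move=> w0; apply: (@continuous_comp _ _ _ (fun w : C^o => w + 'i%C : C^o)
    (@sqrtc R : C^o -> C^o)); first exact: shift.
  exact/continuous_sqrtc/addi_gt0.
have mc (w : HH R) : {for (HH_val w : C^o), continuous (mobius (mp_pi s) : C^o -> C^o)}.
  apply: differentiable_continuous; apply/derivable1_diffP.
  exact: mobius_derivable.
suff : f z = g z by rewrite /f /g extendE.
apply: (@sqr_eq_continuous _ f g _ _ _ _ HHi) => [w|w|w|w|].
- have fc := continuous_comp (mc w) (sqrtc_addi _ (mobius_im (mp_pi s) (HH_im w))).
  exact: (cvgM fc (@holomorphic_continuous _ (@mp_hol _ s) w)).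
- exact: (cvgM (cvg_cst _) (sqrtc_addi _ (HH_im w))).
- rewrite /f /g !exprMn !sqr_sqrtc extendE !mp_sqr.
  exact: (SO2_act_addi w sK).
- rewrite /g mulf_neq0 ?mp_eta_neq0 // sqrtc_eq0.
  by apply: contraTneq (addi_gt0 _ (HH_im w)) => ->; rewrite ltxx.
- rewrite /f /g extendE mulrC.
  by rewrite -[mobius _ _]/(HH_val (act (mp_pi s) HHi)) SO2_act_i.
Qed.

(** Gathers all square roots into one base with the odd exponent 2m; the extra k in the exponent of
    z + i contributes an even power of the root, which is an honest k-th power. *)
Lemma F_kmE k n s (w := HH_val (act (mp_pi s) HHi)) :
  F_km k (5 / 2 + n%:R) s =
  (sqrtc (2 * 'i%C) / (sqrtc (w + 'i%C) * mp_eta s HHi)) ^+ (5 + 2 * n)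
    * ((w - 'i%C) / (w + 'i%C)) ^+ k.
Proof.
set m : rat := 5 / 2 + n%:R.
have mE : numq (2 * m) = (5 + 2 * n)%N.
  rewrite /m mulrDr mulrCA divff // mulr1 -natrM -natrD.
  by rewrite -[_%:R]/((5 + 2 * n)%N%:~R : rat) numq_int.
have mkE : numq (2 * (m + k%:R)) = (5 + 2 * n + 2 * k)%N.
  rewrite /m mulrDr mulrDr mulrCA divff // mulr1 -!natrM -!natrD.
  by rewrite -[_%:R]/((5 + 2 * n + 2 * k)%N%:~R : rat) numq_int.
rewrite /F_km /f_km /hpow mE mkE -/w -exprnN.
move: (5 + 2 * n)%N => M; move: (sqrtc (2 * _)) (mp_eta s HHi) => c e.
rewrite -[_ ^ (M + 2 * k)%N]/(_ ^+ (M + 2 * k)) -[c ^ M]/(c ^+ M).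
rewrite exprD (exprM _ 2 k) sqr_sqrtc !expr_div_n exprMn !invfM.
ring.
Qed.

(** In [F_kmE] the base of the power 5 + 2n acquires e^-1, where e is the value at i of the factor
    of [s], and the Cayley quotient acquires e^-4: e^-2 from z - i and e^2 from z + i, while the
    common factor in z cancels. *)
Lemma F_kmK k n s t : K s ->
  F_km k (5 / 2 + n%:R) (s * t)%g
  = mp_eta s HHi ^- (5 + 2 * n + 4 * k) * F_km k (5 / 2 + n%:R) t.
Proof.
move=> sK; rewrite !F_kmE.
have -> : act (mp_pi (s * t)%g) HHi = act (mp_pi s) (act (mp_pi t) HHi).
  exact: actM.
have -> : mp_eta (s * t)%g HHi =
  mp_eta s (act (mp_pi t) HHi) * mp_eta t HHi by [].
set z := act (mp_pi t) HHi; set e := mp_eta s HHi.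
have e0 : e != 0 by exact: mp_eta_neq0.
have q0 := mp_eta_neq0 s z.
have addi_neq0 (w : HH R) : HH_val w + 'i%C != 0.
  have : 0 < complex.Im (HH_val w + 'i%C).
    by have := HH_im w; case: (HH_val w) => x y /= y0; rewrite addr_gt0.
  by apply: contraTneq => ->; rewrite ltxx.
have [zp z0] := (addi_neq0 (act (mp_pi s) z), addi_neq0 z).
have -> : sqrtc (HH_val (act (mp_pi s) z) + 'i%C) * (mp_eta s z * mp_eta t HHi)
   = e * (sqrtc (HH_val z + 'i%C) * mp_eta t HHi).
  by rewrite mulrA K_sqrtc_addi // -mulrA.
have -> : (HH_val (act (mp_pi s) z) - 'i%C) / (HH_val (act (mp_pi s) z) + 'i%C)
   = e ^- 4 * ((HH_val z - 'i%C) / (HH_val z + 'i%C)).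
  have := SO2_act_subi z sK; have := SO2_act_addi z sK.
  rewrite -[factor_j (mp_pi s) 'i%C]/(factor_j _ (HH_val HHi)) -!mp_sqr -/e.
  move: zp z0; move: (HH_val (act _ _)) (HH_val z) (mp_eta s z) q0.
  move=> w' w q q0 w'0 w0 E1 E2; rewrite -E2.
  have -> : w + 'i%C = (w' + 'i%C) * q ^+ 2 / e ^+ 2.
    by rewrite E1 mulrAC divff ?mul1r // expf_neq0.
  by field; rewrite w'0 q0 e0.
set x := sqrtc (2 * 'i%C); set y := sqrtc _ * _; set u := _ / (HH_val z + _).
move: x y u (5 + 2 * n)%N => x y u M.
rewrite exprD (exprM _ 4 k) (invfM (e ^+ M)) (exprMn _ (e ^- 4)) exprVn.
rewrite !expr_div_n exprMn (invfM (e ^+ M)).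
ring.
Qed.

(* kappa lies over an integral rotation, so e = eta(i) is an 8th root of unity,
   on which an odd power acts injectively since p ^ 2 = 1 mod 8. *)
Lemma K_Gamma1_eta_odd s p : Gamma1 s -> K s -> odd p ->
  mp_eta s HHi ^+ p = 1 -> s = 1%g.
Proof.
rewrite /Gamma1 /K /= => sZ sK podd ep; set e := mp_eta s HHi in ep.
have e8 : e ^+ 8 = 1.
  have [d c] := SO2_entries sK; have := SL2_detE (mp_pi s).
  rewrite (exprM e 2 4) mp_sqr /factor_j d c /=.
  have /intrP[a ->] := sZ 0 0; have /intrP[b ->] := sZ 0 1.
  rewrite mulrN opprK -!expr2 -!rmorphXn -rmorphD /= -[RHS]/(1%:~R) => /eqP.
  rewrite eqr_int => /eqP ab.
  have /orP[/eqP a0|/eqP b0] : (a == 0) || (b == 0).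
    apply: contra_eqT ab; rewrite negb_or => /andP[a0 b0].
    have : 0 < a ^+ 2 by rewrite exprn_even_gt0.
    have : 0 < b ^+ 2 by rewrite exprn_even_gt0.
    by rewrite gtz0_ge1 => h1; rewrite gtz0_ge1 => h2; apply/eqP; lia.
  - have -> : (a%:~R%:C%C : C) = 0 by rewrite a0.
    have b2 : (b%:~R : R) ^+ 2 = 1.
      by rewrite -rmorphXn /= -[RHS](rmorph1 (intr : int -> R)) -ab a0 expr0n add0r.
    rewrite addr0 exprMn (exprM 'i%C 2 2) sqr_i (exprM _ 2 2) sqrrN rmorphN sqrrN.
    by rewrite -rmorphXn /= b2 !expr1n mul1r.
  - have -> : ((- b%:~R)%:C%C : C) = 0 by rewrite b0 /= oppr0.
    have a2 : (a%:~R : R) ^+ 2 = 1.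
      by rewrite -rmorphXn /= -[RHS](rmorph1 (intr : int -> R)) -ab b0 expr0n addr0.
    by rewrite mul0r add0r (exprM _ 2 2) -rmorphXn /= a2 !expr1n.
have e1 : e = 1.
  have pp : (p * p = 8 * (p * p %/ 8) + 1)%N.
    rewrite {1}(divn_eq (p * p) 8) mulnC; congr addn.
    rewrite -modnMm; have : (p %% 8 < 8)%N by rewrite ltn_mod.
    have : odd (p %% 8) by rewrite (odd_mod _ (erefl : odd 8 = false)) podd.
    by case: (p %% 8)%N => [|[|[|[|[|[|[|[|?]]]]]]]].
  have := congr1 (fun x => x ^+ p) ep; rewrite /= expr1n -exprM pp exprD exprM.
  by rewrite e8 expr1n mul1r.
have g1 : mp_pi s = 1%g.
  have [d c] := SO2_entries sK.
  have := mp_sqr s HHi; rewrite -/e e1 expr1n /factor_j d c.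
  move=> /eqP; rewrite eq_complex /= => /andP[/eqP E1 /eqP E2].
  apply: val_inj; apply/matrixP => i j; rewrite !mxE.
  have a1 : mp_pi s 0 0 = 1 by rewrite E1; ring.
  have b0 : mp_pi s 0 1 = 0.
    by apply/eqP; rewrite -oppr_eq0; apply/eqP; rewrite E2; ring.
  case: i => [[|[|//]] hi]; case: j => [[|[|//]] hj] /=.
  - by rewrite -[RHS]a1; congr (SL2_mx _ _ _); apply: val_inj.
  - by rewrite -[RHS]b0; congr (SL2_mx _ _ _); apply: val_inj.
  - by rewrite -[RHS]oppr0 -[in RHS]b0 -c; congr (SL2_mx _ _ _); apply: val_inj.
  - by rewrite -[RHS]a1 -d; congr (SL2_mx _ _ _); apply: val_inj.
by apply: (mp_eta_inj (z0 := HHi)).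
Qed.

End MetaplecticCharacter.

(** * Nonnegative families with bounded finite sums *)

Section BoundedSums.
Context {R : realType}.

(** For nonnegative [w] this is summability with total at most [M], phrased on finite lists so that
    comparisons and products need no topology. *)
Definition bounded_sums (T : eqType) (w : T -> R) (M : R) :=
  forall s : seq T, uniq s -> \sum_(i <- s) w i <= M.

Lemma ler_sum_subset (T : eqType) (w : T -> R) (s t : seq T) :
  (forall x, 0 <= w x) -> uniq s -> {subset s <= t} ->
  \sum_(i <- s) w i <= \sum_(i <- t) w i.
Proof.
move=> w0; elim: s t => [|x s IH] t; first by rewrite big_nil sumr_ge0.
move=> /= /andP[xs us] st.
have xt : x \in t by apply: st; rewrite inE eqxx.
rewrite (perm_big _ (perm_to_rem xt)) /= !big_cons lerD2l IH // => y ys.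
have : y \in x :: rem x t.
  by rewrite -(perm_mem (perm_to_rem xt)) st // inE ys orbT.
rewrite inE => /orP[/eqP yx|//].
by rewrite -yx ys in xs.
Qed.

(** A finite set of pairs lies in the rectangle spanned by its two projections, over which the sum
    factors. *)
Lemma bounded_sums_prod (T U : eqType) (w1 : T -> R) (w2 : U -> R) M1 M2 :
  (forall x, 0 <= w1 x) -> (forall y, 0 <= w2 y) ->
  bounded_sums w1 M1 -> bounded_sums w2 M2 ->
  bounded_sums (fun p : T * U => w1 p.1 * w2 p.2) (M1 * M2).
Proof.
move=> w10 w20 b1 b2 s us.
apply: le_trans (_ : \sum_(p <- [seq (x, y) | x <- undup (map fst s),
  y <- undup (map snd s)]) w1 p.1 * w2 p.2 <= _).
  apply: ler_sum_subset => // [p|[x y] ps]; first exact: mulr_ge0.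
  by apply: allpairs_f; rewrite mem_undup; apply/mapP; exists (x, y).
rewrite big_allpairs /= -big_distrlr /=.
by apply: ler_pM; rewrite ?sumr_ge0 // ?b1 ?b2 // undup_uniq.
Qed.

Lemma bounded_sums_inj (T U : eqType) (h : T -> U) (f : T -> R) (w : U -> R) c M :
  injective h -> 0 <= c -> (forall x, f x <= c * w (h x)) ->
  bounded_sums w M -> bounded_sums f (c * M).
Proof.
move=> hI c0 fw b s us; apply: le_trans (_ : \sum_(x <- s) c * w (h x) <= _).
  exact: ler_sum.
rewrite -big_distrr /= ler_wpM2l //.
by have := b (map h s); rewrite big_map map_inj_uniq //; apply.
Qed.

Lemma partial_sumE (I : choiceType) (V : zmodType) (x : I -> V) (A : {fset I}) :
  partial_sum x A = \sum_(i <- A) x i.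
Proof. by rewrite /partial_sum big_seq_fsetE. Qed.

(* Beyond a finite set on which the absolute sum is within e of its supremum,
   all further partial sums differ by less than e. *)
Lemma bounded_sums_cvg (I : choiceType) (f : I -> R) M :
  bounded_sums (fun i => `|f i|) M -> cvg (partial_sum f @ totally).
Proof.
move=> b; pose S := range (partial_sum (fun i => `|f i|)).
have supS : has_sup S.
  split; first by exists (partial_sum (fun i => `|f i|) fset0); exists fset0.
  by exists M => _ [A _ <-]; rewrite partial_sumE; apply: b; exact: fset_uniq.
have FF : ProperFilter (totally : set_system {fset I}) := @totally_filter I.
apply: cauchy_cvg; apply: (@cauchy_exP R) => e e0.
have [_ [A _ <-] Ae] := sup_adherent e0 supS.
exists (partial_sum f A); exists A => // B /= AB; rewrite /ball /=.
have splitB (h : I -> R) :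
    partial_sum h B = partial_sum h A + \sum_(i <- B | i \notin A) h i.
  rewrite !partial_sumE (bigID (mem A)) /=; congr (_ + _).
  rewrite -big_filter; apply: perm_big; apply: uniq_perm; rewrite ?filter_uniq //.
  move=> i; rewrite mem_filter /= andb_idr //; exact: (fsubsetP AB).
have BS : partial_sum (fun i => `|f i|) B <= sup S.
  by apply: sup_upper_bound => //; exists B.
rewrite splitB opprD addNKr normrN.
apply: le_lt_trans (ler_norm_sum _ _ _) _.
by move: BS; rewrite splitB; lra.
Qed.

End BoundedSums.

(** * Unordered complex sums: convergence, reindexing, vanishing *)

Section SummableComplex.
Context {R : realType}.
Local Notation C := R[i].

(** The real and imaginary parts are dominated by the modulus and converge separately. The modulus
    is itself an element of [C], whence the [complex.Re]. *)
Lemma bounded_sums_cvgC (I : choiceType) (f : I -> C) M :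
  bounded_sums (fun i => complex.Re `|f i|) M ->
  cvg (partial_sum (f : I -> C^o) @ totally).
Proof.
move=> b.
have FF : ProperFilter (totally : set_system {fset I}) := @totally_filter I.
have bReIm (h : C -> R) : (forall z, `|h z| <= complex.Re `|z|) ->
    cvg (partial_sum (h \o f) @ totally).
  move=> hn; apply: (@bounded_sums_cvg _ _ _ M) => s us.
  by apply: le_trans (b s us); apply: ler_sum => i _; exact: hn.
have cRe : cvg (partial_sum (@complex.Re R \o f) @ totally).
  apply: bReIm => -[x y]; rewrite normc_def /= -sqrtr_sqr ler_wsqrtr //.
  by rewrite lerDl sqr_ge0.
have cIm : cvg (partial_sum (@complex.Im R \o f) @ totally).
  apply: bReIm => -[x y]; rewrite normc_def /= -sqrtr_sqr ler_wsqrtr //.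
  by rewrite lerDr sqr_ge0.
have toC (u : {fset I} -> R) : cvg (u @ totally) ->
    cvg ((fun A => (u A)%:C%C : C^o) @ totally).
  move=> uc; apply/cvg_ex; exists ((lim (u @ totally))%:C%C).
  exact: (cvg_comp _ _ uc (@continuous_real_complex R _)).
suff -> : partial_sum (f : I -> C^o) =
    (fun A => (partial_sum (@complex.Re R \o f) A)%:C%C : C^o) \+
    (fun A => (partial_sum (@complex.Im R \o f) A)%:C%C : C^o) \* cst ('i%C : C^o).
  by apply: is_cvgD; [exact: toC | apply: is_cvgM; [exact: toC | exact: is_cvg_cst]].
apply/funext => A /=; rewrite !partial_sumE !rmorph_sum /= big_distrl -big_split /=.
apply: eq_bigr => i _; rewrite mulrC; exact: complexE.
Qed.

(** The image of [B] under [h] contains [A] as soon as [B] contains the image of [A] under [h'], so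
    taking images preserves the limit along finite subsets. *)
Lemma sum_reindex (I : choiceType) (x : I -> C^o) (h h' : I -> I) :
  cancel h h' -> cancel h' h -> cvg (partial_sum x @ totally) ->
  partial_sum (x \o h) @ totally --> sum x.
Proof.
move=> hK h'K xc.
have FF : ProperFilter (totally : set_system {fset I}) := @totally_filter I.
rewrite (_ : partial_sum (x \o h) = partial_sum x \o (fun A => [fset h a | a in A]%fset)).
  apply: cvg_comp xc => P [A _ AP]; exists [fset h' a | a in A]%fset => // B AB.
  apply: AP => /=; apply/fsubsetP => a aA; apply/imfsetP; exists (h' a) => //=.
  by apply: (fsubsetP AB); apply: in_imfset.
apply/funext => A /=; rewrite !partial_sumE big_imfset //= => a b _ _.
exact: (can_inj hK).
Qed.

(** The reindexed partial sums tend both to [sum x] and to [c * sum x]. *)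
Lemma sum_eq0_twist (I : choiceType) (x : I -> C^o) (h h' : I -> I) (c : C) :
  cancel h h' -> cancel h' h -> cvg (partial_sum x @ totally) ->
  (forall i, x (h i) = c * x i) -> c != 1 -> sum x = 0.
Proof.
move=> hK h'K xc xh c1.
have FF : ProperFilter (totally : set_system {fset I}) := @totally_filter I.
have cS : partial_sum (x \o h) @ totally --> (c * sum x : C^o).
  rewrite (_ : partial_sum (x \o h) = (fun A => (c : C^o) * partial_sum x A)).
    by apply: cvgM xc; exact: cvg_cst.
  by apply/funext => A; rewrite !partial_sumE big_distrr; apply: eq_bigr => i _; exact: xh.
have /eqP : c * sum x = sum x.
  by apply: (@norm_cvg_unique _ C^o) cS (sum_reindex hK h'K xc).
rewrite -subr_eq0 -[X in _ - X]mul1r -mulrBl mulf_eq0 subr_eq0 (negPf c1).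
by move=> /eqP.
Qed.

End SummableComplex.

(** * Counting integral matrices by their Frobenius norm *)

Section Counting.
Context {R : realType}.
Local Notation C := R[i].
Implicit Types (g h : SL2 R).

Definition root4 (n : nat) : R := Num.sqrt (Num.sqrt n.+1%:R).

Lemma root4_pow n : root4 n ^+ 4 = n.+1%:R.
Proof. by rewrite (exprM _ 2 2) !sqr_sqrtr // sqrtr_ge0. Qed.

Lemma root4_gt0 n : 0 < root4 n.
Proof. by rewrite !sqrtr_gt0. Qed.

(* (n + 1) ^ (-5/4), since |F_km| ^ 4 is a (2m)-th power with 2m >= 5. *)
Definition weight (n : nat) : R := root4 n ^- 5.

Lemma weight_ge0 n : 0 <= weight n.
Proof. by rewrite invr_ge0 exprn_ge0 // ltW // root4_gt0. Qed.

(* Makes the sum of the weights telescope. *)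
Lemma inv_pow5_le (a b : R) : 0 < a -> 0 < b -> b ^+ 4 = a ^+ 4 + 1 ->
  b ^- 5 <= 4 * (a^-1 - b^-1).
Proof.
move=> a0 b0 ab.
have ltab : a < b by rewrite -(@ltr_pXn2r _ 4) ?nnegrE ?ltW // ab ltrDl.
have d0 : 0 <= b - a by rewrite subr_ge0 ltW.
have fact : (b - a) * (b ^+ 3 + b ^+ 2 * a + b * a ^+ 2 + a ^+ 3) = 1.
  by transitivity (b ^+ 4 - a ^+ 4); [ring | rewrite ab; ring].
have le4 : 1 <= (b - a) * (4 * b ^+ 3).
  rewrite -[X in X <= _]fact; apply: ler_wpM2l => //.
  have a2 : a ^+ 2 <= b ^+ 2 by rewrite ler_pXn2r ?nnegrE ?ltW.
  have : b ^+ 2 * a <= b ^+ 3 by rewrite (exprSr b 2) ler_wpM2l ?sqr_ge0 1?ltW.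
  have : b * a ^+ 2 <= b ^+ 3 by rewrite (exprS b 2) ler_wpM2l // ltW.
  have : a ^+ 3 <= b ^+ 3 by rewrite ler_pXn2r ?nnegrE ?ltW.
  lra.
have -> : 4 * (a^-1 - b^-1) = (b - a) * (4 * b ^+ 4) / (a * b ^+ 5).
  by field; rewrite !gt_eqF.
rewrite ler_pdivlMr ?mulr_gt0 ?exprn_gt0 // mulrC mulfK ?gt_eqF ?exprn_gt0 //.
have -> : (b - a) * (4 * b ^+ 4) = (b - a) * (4 * b ^+ 3) * b by ring.
apply: le_trans (ltW ltab) _.
by rewrite -[X in X <= _]mul1r ler_wpM2r // ltW.
Qed.

(** The constant 5 is the term 1 at index 0 plus 4 from the telescoping bound [inv_pow5_le]. *)
Lemma sum_weight_le N : \sum_(0 <= i < N.+1) weight i <= 5 - 4 / root4 N.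
Proof.
elim: N => [|N IH].
  rewrite big_nat1 /weight /root4 !sqrtr1 expr1n invr1; lra.
rewrite big_nat_recr //=.
have := @inv_pow5_le (root4 N) (root4 N.+1) (root4_gt0 _) (root4_gt0 _).
rewrite !root4_pow natr1 => /(_ erefl).
by move: IH; rewrite -/(weight N.+1) mulrBr; lra.
Qed.

Lemma bounded_sums_weight : bounded_sums weight 5.
Proof.
move=> s us; pose N := \max_(i <- s) i.
apply: le_trans (_ : \sum_(i <- index_iota 0 N.+1) weight i <= _).
  apply: ler_sum_subset => //; first exact: weight_ge0.
  by move=> i iS; rewrite mem_index_iota ltnS /=; apply: leq_bigmax_seq.
apply: le_trans (sum_weight_le _) _.
by rewrite lerBlDr lerDl divr_ge0 // ltW // root4_gt0.
Qed.

Lemma bounded_sums_bool : bounded_sums (fun _ : bool => 1 : R) 2.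
Proof.
move=> s us; rewrite big_const_seq count_predT iter_addr_0 ler_nat.
by rewrite -card_bool cardE; apply: uniq_leq_size => // x _; rewrite mem_enum.
Qed.

(** An integer is determined by its sign and its absolute value; the sign costs the factor 2. *)
Lemma bounded_sums_absz : bounded_sums (fun z : int => weight `|z|) (1 * (2 * 5)).
Proof.
apply: (@bounded_sums_inj _ _ _ (fun z : int => (z < 0, `|z|%N)) _
   (fun p => 1 * weight p.2)) => // [x y [] xy axy|x|].
- by move: xy axy; case: x y => m [] n //= _; lia.
- by rewrite !mul1r.
- exact: (@bounded_sums_prod R _ _ (fun=> 1) weight _ _ (fun=> ler01) weight_ge0
    bounded_sums_bool bounded_sums_weight).
Qed.

(** The squared Frobenius norm. *)
Definition hs g : R := g 0 0 ^+ 2 + g 0 1 ^+ 2 + g 1 0 ^+ 2 + g 1 1 ^+ 2.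

Lemma hs_ge0 g : 0 <= hs g.
Proof. by rewrite /hs !addr_ge0 // sqr_ge0. Qed.

(** The norm is submultiplicative on g = (gh) h^-1, and h^-1, being the adjugate of h, has the norm
    of h. *)
Lemma hs_mulr_le g h : hs g <= hs (g * h)%g * hs h.
Proof.
pose k := (g * h)%g.
have gk : g = (k * h^-1)%g by rewrite /k mulgK.
have e00 : k 0 0 = g 0 0 * h 0 0 + g 0 1 * h 1 0.
  by rewrite !mxE !big_ord_recl !big_ord0 addr0 !lift01.
have e01 : k 0 1 = g 0 0 * h 0 1 + g 0 1 * h 1 1.
  by rewrite !mxE !big_ord_recl !big_ord0 addr0 !lift01.
have e10 : k 1 0 = g 1 0 * h 0 0 + g 1 1 * h 1 0.
  by rewrite !mxE !big_ord_recl !big_ord0 addr0 !lift01.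
have e11 : k 1 1 = g 1 0 * h 0 1 + g 1 1 * h 1 1.
  by rewrite !mxE !big_ord_recl !big_ord0 addr0 !lift01.
have D := SL2_detE h.
have g00 : g 0 0 = k 0 0 * h 1 1 - k 0 1 * h 1 0.
  by rewrite e00 e01 -[LHS]mulr1 -D; ring.
have g01 : g 0 1 = k 0 1 * h 0 0 - k 0 0 * h 0 1.
  by rewrite e00 e01 -[LHS]mulr1 -D; ring.
have g10 : g 1 0 = k 1 0 * h 1 1 - k 1 1 * h 1 0.
  by rewrite e10 e11 -[LHS]mulr1 -D; ring.
have g11 : g 1 1 = k 1 1 * h 0 0 - k 1 0 * h 0 1.
  by rewrite e10 e11 -[LHS]mulr1 -D; ring.
rewrite -/k {1}/hs g00 g01 g10 g11 /hs.
move: (k 0 0) (k 0 1) (k 1 0) (k 1 1) (h 0 0) (h 0 1) (h 1 0) (h 1 1).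
move=> a b c d x y z t; rewrite -subr_ge0.
(* One Lagrange identity for each entry of [g] gives the defect in the Cauchy-Schwarz inequality as
   a square. *)
rewrite [X in 0 <= X](_ : _ = (a * z + b * t) ^+ 2 + (a * x + b * y) ^+ 2
  + (c * z + d * t) ^+ 2 + (c * x + d * y) ^+ 2); last by ring.
by rewrite !addr_ge0 // sqr_ge0.
Qed.

(* Orthogonal projection of the top row (a, b) to the line of the bottom row
   (c, d): the integral rows completing (c, d) are (a, b) + k (c, d), and this
   moves the slope by k. *)
Definition slope g : R :=
  (g 0 0 * g 1 0 + g 0 1 * g 1 1) / (g 1 0 ^+ 2 + g 1 1 ^+ 2).

(** On integral matrices the first two floors are exact; only the third rounds. *)
Definition code g : int * int * int :=
  (Num.floor (g 1 0), Num.floor (g 1 1), Num.floor (slope g)).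

Lemma bottom_row_gt0 g : 0 < g 1 0 ^+ 2 + g 1 1 ^+ 2.
Proof.
rewrite lt0r addr_ge0 ?sqr_ge0 // andbT paddr_eq0 ?sqr_ge0 // !sqrf_eq0.
apply/negP => /andP[/eqP c /eqP d]; have /eqP := SL2_detE g.
by rewrite c d !mulr0 subrr eq_sym oner_eq0.
Qed.

Lemma bottom_row_ge1 g : SL2Z g -> 1 <= g 1 0 ^+ 2 + g 1 1 ^+ 2.
Proof.
move=> gZ; have := bottom_row_gt0 g.
have /intrP[c ->] := gZ 1 0; have /intrP[d ->] := gZ 1 1.
by rewrite -!rmorphXn -rmorphD /= ltr0z -[1]/(1%:~R) ler_int gtz0_ge1.
Qed.

Lemma code_inj g h : SL2Z g -> SL2Z h -> code g = code h -> g = h.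
Proof.
move=> gZ hZ [] /(congr1 (intr : int -> R)) c /(congr1 (intr : int -> R)) d n.
have flE (x : R) : x \is a Num.int -> (Num.floor x)%:~R = x.
  by rewrite intrEfloor => /eqP.
rewrite !flE // in c; rewrite !flE // in d.
have U0 : g 1 0 ^+ 2 + g 1 1 ^+ 2 != 0 by rewrite gt_eqF ?bottom_row_gt0.
have Dg := SL2_detE g; have Dh := SL2_detE h.
(* This is the upper right entry of g h^-1, which is unipotent because the bottom rows agree. *)
pose k := g 0 0 * (g 0 1 - h 0 1) - g 0 1 * (g 0 0 - h 0 0).
have kZ : k \is a Num.int by rewrite rpredB ?rpredM ?rpredB.
have ka : g 0 0 - h 0 0 = k * g 1 0.
  rewrite -c -d in Dh; rewrite -[LHS]mulr1 -{1}Dg /k.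
  have -> : g 0 0 * (g 0 1 - h 0 1) - g 0 1 * (g 0 0 - h 0 0)
     = g 0 1 * h 0 0 - g 0 0 * h 0 1 by ring.
  transitivity ((g 0 1 * h 0 0 - g 0 0 * h 0 1) * g 1 0 +
    (g 0 0 * ((g 0 0 * g 1 1 - g 0 1 * g 1 0) - (h 0 0 * g 1 1 - h 0 1 * g 1 0)))).
    by ring.
  by rewrite Dg Dh subrr mulr0 addr0.
have kb : g 0 1 - h 0 1 = k * g 1 1.
  rewrite -c -d in Dh; rewrite -[LHS]mulr1 -{1}Dg /k.
  have -> : g 0 0 * (g 0 1 - h 0 1) - g 0 1 * (g 0 0 - h 0 0)
     = g 0 1 * h 0 0 - g 0 0 * h 0 1 by ring.
  transitivity ((g 0 1 * h 0 0 - g 0 0 * h 0 1) * g 1 1 +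
    (g 0 1 * ((g 0 0 * g 1 1 - g 0 1 * g 1 0) - (h 0 0 * g 1 1 - h 0 1 * g 1 0)))).
    by ring.
  by rewrite Dg Dh subrr mulr0 addr0.
have slopeE : slope g = slope h + k.
  rewrite /slope -c -d.
  have -> : g 0 0 = h 0 0 + k * g 1 0 by rewrite -ka addrC subrK.
  have -> : g 0 1 = h 0 1 + k * g 1 1 by rewrite -kb addrC subrK.
  by field.
have k0 : k = 0.
  have : Num.floor k = 0.
    by apply: (addrI (Num.floor (slope h))); rewrite addr0 -floorDrz // -slopeE.
  by move=> /(congr1 (intr : int -> R)); rewrite flE.
move: ka kb; rewrite k0 !mul0r => /eqP; rewrite subr_eq0 => /eqP a.
move=> /eqP; rewrite subr_eq0 => /eqP b.
apply: val_inj; apply/matrixP.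
have ord2 (P : 'I_2 -> Prop) : P 0 -> P 1 -> forall i, P i.
  by move=> P0 P1 [[|[|//]] Hi]; [move: P0 | move: P1];
    congr P; apply: val_inj.
by apply: (@ord2 _); apply: (@ord2 _).
Qed.

Lemma code_hs_le g : SL2Z g ->
  ((`|(code g).1.1|.+1 * `|(code g).1.2|.+1 * `|(code g).2|.+1)%:R : R) <= 9 * hs g.
Proof.
move=> gZ; have U1 := bottom_row_ge1 gZ; have U0 := bottom_row_gt0 g.
have flE (x : R) : x \is a Num.int -> (Num.floor x)%:~R = x.
  by rewrite intrEfloor => /eqP.
have absE (z : int) : (`|z|%N.+1%:R : R) = `|z%:~R| + 1.
  by rewrite -natr1 -intr_norm -abszE.
rewrite !natrM !absE /= (flE (g 1 0)) // (flE (g 1 1)) //.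
set U := _ + _ in U0 U1.
pose p := g 0 0 * g 1 0 + g 0 1 * g 1 1.
(* Lagrange's identity for the two rows: the product of their squared norms is p^2 plus the squared
   determinant. *)
have hsU : hs g * U = U ^+ 2 + p ^+ 2 + 1.
  rewrite -[X in _ + X](expr1n _ 2) -(SL2_detE g) /hs /p /U; ring.
have cd : (`|g 1 0| + 1) * (`|g 1 1| + 1) <= 3 * U.
  have Ue : U = `|g 1 0| ^+ 2 + `|g 1 1| ^+ 2 by rewrite !real_normK ?num_real.
  move: (`|g 1 0|) (`|g 1 1|) Ue => x y Ue.
  (* This yields x + y + xy <= U + 1, and U >= 1 absorbs the constants. *)
  have : 0 <= (x - 1) ^+ 2 + (y - 1) ^+ 2 + (x - y) ^+ 2.
    by rewrite !addr_ge0 // sqr_ge0.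
  rewrite Ue in U1 *; nra.
have nU : (`|(Num.floor (slope g))%:~R : R| + 1) * U <= 2 * U + `|p|.
  have sU : `|slope g| * U = `|p|.
    by rewrite /slope normrM normfV -/U (gtr0_norm U0) divfK ?gt_eqF.
  rewrite -sU -mulrDl; apply: ler_wpM2r; first exact: ltW.
  have : `|(Num.floor (slope g))%:~R - slope g| <= 1.
    have := floor_le (slope g); have := floorD1_gt (slope g).
    by rewrite rmorphD /= ler_norml; lra.
  have := ler_normD (slope g) ((Num.floor (slope g))%:~R - slope g).
  by rewrite addrC subrK; lra.
have n0 : 0 <= `|(Num.floor (slope g))%:~R : R| + 1 by rewrite addr_ge0.
rewrite -(ler_pM2r U0) -[9 * _ * U]mulrA hsU.
apply: le_trans (_ : 3 * U * (2 * U + `|p|) <= _).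
  rewrite -(mulrA _ _ U); apply: ler_pM => //.
  by apply: mulr_ge0 => //; exact: ltW.
have : 0 <= (U - `|p|) ^+ 2 by exact: sqr_ge0.
have -> : p ^+ 2 = `|p| ^+ 2 by rewrite real_normK ?num_real.
nra.
Qed.

End Counting.

(** * Domination of the Poincare series *)

Section Poincare.
Context {R : realType}.
Local Notation C := R[i].
Implicit Types (s t : Mp R).

Lemma normr_subi_le (z : HH R) : `|(HH_val z - 'i%C) / (HH_val z + 'i%C)| <= 1.
Proof.
have y0 := HH_im z.
have zi : 0 < `|HH_val z + 'i%C|.
  rewrite normr_gt0; apply/eqP => /(congr1 (@complex.Im R)).
  by move: y0; case: (HH_val z) => x y /= y0; lra.
rewrite normrM normfV ler_pdivrMr // mul1r !normc_def lecR.
by move: y0; case: (HH_val z) => x y /= y0; apply: ler_wsqrtr; nra.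
Qed.

(** The product inside is (b - c) + (a + d) i, and the cross terms of its squared modulus add up to
    twice the determinant. *)
Lemma normr_addi_factor (g : SL2 R) :
  `|(HH_val (act g HHi) + 'i%C) * factor_j g HHi| ^+ 2 = (hs g + 2)%:C%C.
Proof.
have nz := factor_j_neq0 g (HH_im HHi).
rewrite mulrDl /= /mobius divfK // -add_Re2_Im2 /factor_j /=.
congr (_%:C)%C; have := SL2_detE g; rewrite /hs.
move: (g 0 0) (g 0 1) (g 1 0) (g 1 1) => a b c d D.
transitivity (a ^+ 2 + b ^+ 2 + c ^+ 2 + d ^+ 2 + 2 * (a * d - b * c)).
  ring.
by rewrite D mulr1.
Qed.

Lemma hs_ge2 (g : SL2 R) : 2 <= hs g.
Proof.
have D := SL2_detE g; rewrite /hs.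
move: (g 0 0) (g 0 1) (g 1 0) (g 1 1) D => a b c d D.
have : 0 <= (a - d) ^+ 2 + (b + c) ^+ 2 by rewrite addr_ge0 // sqr_ge0.
have -> : (a - d) ^+ 2 + (b + c) ^+ 2 =
  a ^+ 2 + b ^+ 2 + c ^+ 2 + d ^+ 2 - 2 * (a * d - b * c) by ring.
by rewrite D mulr1 subr_ge0.
Qed.

(** Fourth powers remove all square roots: the base in [F_kmE] has modulus [r] to the power 1/4. The
    Cayley quotient has modulus at most 1, and r <= 1 by [hs_ge2], so the exponent 5 + 2n drops to
    5. *)
Lemma F_km_norm_le k n s :
  complex.Re `|F_km k (5 / 2 + n%:R) s| ^+ 4 <= (4 / (hs (mp_pi s) + 2)) ^+ 5.
Proof.
set F := F_km _ _ _; set r := 4 / _.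
have h2 := hs_ge2 (mp_pi s).
have r0 : 0 <= r by rewrite divr_ge0 //; lra.
have r1 : r <= 1 by rewrite ler_pdivrMr; lra.
suff : `|F| ^+ 4 <= (r ^+ 5)%:C%C.
  by rewrite -(RRe_real (normr_real F)) -rmorphXn lecR.
rewrite /F F_kmE normrM !normrX; set rho := _ / (_ * _); set u := _ / _.
have rho4 : `|rho| ^+ 4 = r%:C%C.
  rewrite (exprM _ 2 2) -normrX /rho expr_div_n exprMn !sqr_sqrtc mp_sqr.
  rewrite normrM normfV expr_div_n normr_addi_factor -add_Re2_Im2 /=.
  rewrite -[RHS]/((4 / (hs (mp_pi s) + 2))%:C%C) fmorph_div /=.
  by congr (_%:C%C / _); ring.
have u1 : `|u| ^+ k <= 1 by rewrite exprn_ile1 // normr_subi_le.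
apply: le_trans (_ : (`|rho| ^+ (5 + 2 * n)) ^+ 4 <= _).
  have A0 : 0 <= `|rho| ^+ (5 + 2 * n) by exact: exprn_ge0.
  have B0 : 0 <= `|u| ^+ k by exact: exprn_ge0.
  move: (`|rho| ^+ _) (`|u| ^+ k) A0 B0 u1 => A B A0 B0 B1.
  rewrite ler_pXn2r ?nnegrE //; first by rewrite -[leRHS]mulr1 ler_wpM2l.
  exact: mulr_ge0.
rewrite exprAC rho4 -rmorphXn lecR exprD -[leRHS]mulr1.
by rewrite ler_wpM2l ?exprn_ge0 // exprn_ile1.
Qed.

(** The boolean separates the two lifts of one matrix. *)
Definition mp_code s : int * int * int * bool :=
  (code (mp_pi s), mp_eta s HHi == sqrtc (factor_j (mp_pi s) HHi)).

Lemma mp_code_inj s t : Gamma1 s -> Gamma1 t -> mp_code s = mp_code t -> s = t.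
Proof.
move=> sZ tZ; rewrite /mp_code => /pair_equal_spec[/(code_inj sZ tZ) st].
rewrite st => est; apply: (mp_eta_inj (z0 := HHi)) => //.
have sgn (v : Mp R) : mp_pi v = mp_pi t -> mp_eta v HHi =
    (if mp_eta v HHi == sqrtc (factor_j (mp_pi t) HHi) then 1 else -1) *
    sqrtc (factor_j (mp_pi t) HHi).
  move=> vt; case: eqP => [->|/eqP ne]; first by rewrite mul1r.
  have /eqP := mp_sqr v HHi; rewrite vt -{1}(sqr_sqrtc (factor_j _ _)).
  by rewrite -subr_eq0 subr_sqr mulf_eq0 subr_eq0 (negPf ne) addr_eq0 /= mulN1r => /eqP.
by rewrite (sgn s) // (sgn t) // est.
Qed.

(** The last factor is the constant weight of the boolean, in the product form of
    [bounded_sums_prod]. *)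
Definition code_weight (p : int * int * int * bool) : R :=
  weight `|p.1.1.1| * weight `|p.1.1.2| * weight `|p.1.2| * 1.

Lemma bounded_sums_code_weight : exists M, bounded_sums code_weight M.
Proof.
have w0 (z : int) : 0 <= weight `|z| :> R by exact: weight_ge0.
eexists; apply: (@bounded_sums_prod R _ _ (fun p : int * int * int =>
  weight `|p.1.1| * weight `|p.1.2| * weight `|p.2|) (fun _ : bool => 1)).
- by move=> p; rewrite !mulr_ge0.
- by [].
- apply: (@bounded_sums_prod R _ _ (fun p : int * int =>
    weight `|p.1| * weight `|p.2|) (fun z : int => weight `|z|)).
  + by move=> p; rewrite mulr_ge0.
  + exact: w0.
  + exact: (bounded_sums_prod w0 w0 bounded_sums_absz bounded_sums_absz).
  + exact: bounded_sums_absz.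
- exact: bounded_sums_bool.
Qed.

(** After taking fourth powers, [code_hs_le] for [t] and [hs_mulr_le] bound the product of the three
    integers by 9 times the norms of [t * s] and [s]; the constant 36 is 4 times this 9. *)
Lemma F_km_code_le k n s t : Gamma1 t ->
  complex.Re `|F_km k (5 / 2 + n%:R) (t * s)%g|
  <= Num.sqrt (Num.sqrt (36 * hs (mp_pi s))) ^+ 5 * code_weight (mp_code t).
Proof.
move=> tZ.
have absRe (z : C) : 0 <= complex.Re `|z| by rewrite normc_def sqrtr_ge0.
rewrite -(@ler_pXn2r _ 4) ?nnegrE //; last first.
  by rewrite mulr_ge0 ?exprn_ge0 ?sqrtr_ge0 // !mulr_ge0 ?weight_ge0.
apply: le_trans (F_km_norm_le k n (t * s)%g) _.
have S0 := hs_ge0 (mp_pi s).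
have cE := code_hs_le tZ; rewrite !natrM in cE.
have w4 m : weight m ^+ 4 = (m.+1%:R ^+ 5)^-1 :> R.
  by rewrite /weight exprVn -exprM mulnC exprM root4_pow.
rewrite [in leRHS]exprMn /code_weight mulr1 /=.
have -> : Num.sqrt (Num.sqrt (36 * hs (mp_pi s))) ^+ 5 ^+ 4 = (36 * hs (mp_pi s)) ^+ 5.
  by rewrite exprAC (exprM _ 2 2) !sqr_sqrtr ?sqrtr_ge0 ?mulr_ge0.
rewrite !(exprMn 4) !w4 -!invfM -!exprMn -expr_div_n.
have hst := hs_mulr_le (mp_pi t) (mp_pi s).
rewrite /code /= in cE; set P := _ * _ * _ in cE *.
have P0 : 0 < P by rewrite !mulr_gt0.
have H0 := hs_ge0 (mp_pi t * mp_pi s)%g.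
have L0 : 0 <= 4 / (hs (mp_pi t * mp_pi s)%g + 2) by apply: divr_ge0 => //; lra.
have R0 : 0 <= 36 * hs (mp_pi s) / P by apply: divr_ge0; [lra | exact: ltW].
rewrite ler_pXn2r ?nnegrE // ler_pdivrMr; last by lra.
rewrite mulrAC ler_pdivlMr //.
by clear -cE hst S0; lra.
Qed.

End Poincare.

(** * Convergence, and vanishing by translation *)

Theorem lemma6p4 (R : realType) (G : set (Mp R))
    (G_group : group_closed (mem G)) (G_sub : G `<=` Gamma1)
    (G_K : G `&` K <> [set 1%g]) :
  forall (k : nat) (m : rat), (exists n : nat, m = 5 / 2 + n%:R) ->
    poincare_converges G (F_km k m) /\ poincare G (F_km k m) = cst 0.
Proof.
move=> k _ [n ->].
have conv : poincare_converges G (F_km k (5 / 2 + n%:R)).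
  move=> s; have [M bM] := @bounded_sums_code_weight R.
  apply: bounded_sums_cvgC.
  apply: (bounded_sums_inj (h := fun g : G => mp_code (val g))
    (c := Num.sqrt (Num.sqrt (36 * hs (mp_pi s))) ^+ 5)) bM.
  - move=> g h gh; apply: val_inj; apply: mp_code_inj gh; apply: G_sub; exact: set_valP.
  - by apply: exprn_ge0; exact: sqrtr_ge0.
  - move=> g; apply: F_km_code_le; apply: G_sub; exact: set_valP.
split=> //.
have [G1 GM] := (G_group.1, group_closedM G_group).
(* The intersection always contains 1, so differing from the trivial group means having a nontrivial
   element. *)
have [kap [Gk [Kk k1]]] : exists kap, kap \in G /\ K kap /\ kap <> 1%g.
  apply: contrapT => noK; apply: G_K; apply/seteqP; split => x.
    by move=> [Gx Kx]; apply: contrapT => x1; apply: noK; exists x;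
      split=> //; exact: mem_set.
  move=> ->; split; first exact: set_mem G1.
  by rewrite /K /= /SO2 /= trmx1 mulmx1.
have Gki : (kap^-1)%g \in G by exact: (group_closedV G_group).
pose mulG u (Gu : u \in G) (g : G) : G := exist _ (u * val g)%g (GM _ _ Gu (valP g)).
apply/funext => s /=.
apply: (sum_eq0_twist (h := mulG kap Gk) (h' := mulG kap^-1%g Gki) _ _ (conv s)
  (c := mp_eta kap HHi ^- (5 + 2 * n + 4 * k))).
- by move=> g; apply: val_inj; rewrite /= mulKg.
- by move=> g; apply: val_inj; rewrite /= mulVKg.
- by move=> g; rewrite -F_kmK // mulgA.
(* Were the twisting factor 1, an odd power of the value at i of the factor of [kap] would be 1,
   forcing [kap] to be trivial. *)
apply/eqP => /(congr1 GRing.inv); rewrite invrK invr1 => e; apply: k1.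
apply: (@K_Gamma1_eta_odd _ kap (5 + 2 * n + 4 * k)) => //.
  by apply: G_sub; exact: set_mem Gk.
lia.
Qed.
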